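(* Let $f(k)$ denote the largest integer $s$ such that every $(k,s)$-CNF formula is satisfiable. Then for every positive integer $k$, $$\left\lfloor\frac{2^{k+1}}{ek}\right\rfloor-1 \leq f(k),$$ and moreover $$f(k)=\left(e^{-1}+O(k^{-1/2})\right)\frac{2^{k+1}}{k}\quad\text{as } k\to\infty.$$
   Context: A $k$-CNF formula is a conjunction of clauses, each clause being a disjunction of exactly $k$ distinct literals (a literal is a Boolean variable or its negation). A $(k,s)$-CNF formula is a $k$-CNF formula in which every variable appears in at most $s$ clauses. *)

(* Defs.v *)
From mathcomp Require Import all_boot all_order all_algebra.
From mathcomp Require Import all_classical all_reals all_analysis.

Set Implicit Arguments.
Unset Strict Implicit.
Unset Printing Implicit Defensive.

Local Open Scope classical_set_scope.

(* The variables are the natural numbers; (x, true) is the literal x and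
   (x, false) is its negation. *)
Definition literal : Type := (nat * bool)%type.

(* Disjunctions and conjunctions are sequences.  A formula may thus list the
   same clause several times, each copy counting as an occurrence of its
   variables. *)
Definition clause : Type := seq literal.
Definition formula : Type := seq clause.

Definition clause_holds (a : nat -> bool) (C : clause) : bool :=
  has (fun l => a l.1 == l.2) C.

Definition satisfiable (F : formula) : Prop :=
  exists a : nat -> bool, all (clause_holds a) F.

(* A clause may contain a variable together with its negation. *)
Definition k_cnf (k : nat) (F : formula) : bool :=
  all (fun C : clause => uniq C && (size C == k)) F.

Definition var_in (x : nat) (C : clause) : bool := has (fun l => l.1 == x) C.

Definition ks_cnf (k s : nat) (F : formula) : Prop :=
  k_cnf k F /\ forall x : nat, count (var_in x) F <= s.

Definition all_satisfiable (k s : nat) : Prop :=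
  forall F : formula, ks_cnf k s F -> satisfiable F.

Definition is_largest (P : nat -> Prop) (s : nat) : Prop :=
  P s /\ forall t : nat, P t -> t <= s.

(* The default value 0 is used only for k = 0; see [fP]. *)
Definition f (k : nat) : nat :=
  xget 0 [set s | is_largest (all_satisfiable k) s].

Lemma all_satisfiable_lt (k s : nat) : all_satisfiable k s -> s < 2 ^ k.
Proof.
move=> sat; rewrite ltnNge; apply/negP => les.
pose cl (b : k.-tuple bool) : clause := zip (iota 0 k) b.
have szcl b : size (cl b) = k by rewrite size_zip size_iota size_tuple minnn.
pose F : formula := [seq cl b | b <- enum {: k.-tuple bool}].
have [] := sat F.
  split=> [|x].
    apply/allP => C /mapP[b _ ->]; rewrite szcl eqxx andbT.
    by apply: (@map_uniq _ _ fst); rewrite -/unzip1 unzip1_zip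
      ?iota_uniq// size_iota size_tuple.
  apply: leq_trans (count_size _ _) _.
  by rewrite size_map -cardE card_tuple card_bool.
move=> a /allP/(_ (cl [tuple ~~ a i | i < k])) H.
have /H/hasP[[x b]] : cl [tuple ~~ a i | i < k] \in F.
  by apply: map_f; rewrite mem_enum.
move=> /(nthP (0, false))[i]; rewrite szcl => ik.
rewrite nth_zip ?size_iota ?size_tuple//= nth_iota// add0n => -[<- <-].
rewrite -[i]/(val (Ordinal ik)) (nth_map (Ordinal ik)) ?size_enum_ord//.
by rewrite nth_ord_enum /=; case: (a i).
Qed.

Lemma all_satisfiable0 (k : nat) : 0 < k -> all_satisfiable k 0.
Proof.
move=> k0 [|C F] [/=]; first by exists xpredT.
case: C => [|[x b] C] /=; first by rewrite eq_sym eqn0Ngt k0.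
by move=> _ /(_ x); rewrite /var_in /= eqxx.
Qed.

Lemma fP (k : nat) : 0 < k -> is_largest (all_satisfiable k) (f k).
Proof.
move=> k0; suff [s Ps] : exists s, is_largest (all_satisfiable k) s.
  exact: (@xgetPex _ 0 [set s | is_largest (all_satisfiable k) s]
    (ex_intro _ s Ps)).
have exP : exists s, `[< all_satisfiable k s >].
  by exists 0; apply/asboolP/all_satisfiable0.
have ubP s : `[< all_satisfiable k s >] -> s <= 2 ^ k.
  by move=> /asboolP/all_satisfiable_lt/ltnW.
case: (ex_maxnP exP ubP) => s /asboolP Ps maxs.
by exists s; split=> // t /asboolP; exact: maxs.
Qed.

(* Main.v *)
(* Lower bound: draw the variables independently, x being true with probability
   1/2 + (2 d(~x) - s) / (2 s k), where d counts the occurrences of a literal.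
   A clause C is then violated with probability at most e 2^-k y^D, where
   y = exp(-2 / (s k)) and D is the sum over the literals l of C of d(~l), which
   bounds the number of clauses containing the negation of a literal of C.  The
   lopsided local lemma applies as soon as e 2^-k <= 1 - y.

   Upper bound: a binary tree whose leaves have depth at least k gives an
   unsatisfiable k-CNF formula: the inner nodes are the variables and each leaf
   yields the clause forbidding the last k turns of its branch.  The variable of
   a node occurs as often as the node has leaves within distance k.  A tree with
   at most (1/e + O(k^(-1/2))) 2^(k+1) / k such leaves is built in rounds of
   about k^(1/4) levels.  Of the Q = 2^r subtrees hanging below the r levels of a
   round, r w are closed after 0, ..., r - 1 further levels, so that every
   window of r levels contributes equally, and the others enter the next round.
   The number w of each kind is 0 for q + 1 rounds, where k is close to
   (q + 2) r, then jumps to r^2 and grows by 1 every q + 1 rounds, until it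
   exceeds Q / r^3 and everything is closed.  A node sees
   about 2 Q w (Q - r w)^q leaves, whose maximum over w is about
   2 Q^(q + 2) / (e r q). *)

Require Import Defs.
From mathcomp Require Import all_boot all_order all_algebra.
From mathcomp Require Import all_classical all_reals all_analysis.
From mathcomp Require Import ring lra zify.

Import Order.TTheory GRing.Theory Num.Theory.
Import numFieldNormedType.Exports.

Set Implicit Arguments.
Unset Strict Implicit.
Unset Printing Implicit Defensive.

Local Open Scope classical_set_scope.
Local Open Scope ring_scope.

(** * The lopsided local lemma *)

Definition flip_lit (l : literal) : literal := (l.1, ~~ l.2).

Definition upd (a : nat -> bool) (x : nat) (b : bool) : nat -> bool :=
  fun y => if y == x then b else a y.

(* Expectation of [X] when the variables below [n] are drawn independently, [x]
   taking the value [b] with probability [p x b], and the others follow [a]. *)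
Fixpoint expect (R : realFieldType) (p : nat -> bool -> R) (n : nat)
    (X : (nat -> bool) -> R) (a : nat -> bool) : R :=
  if n is n'.+1 then
    p n' true * expect p n' X (upd a n' true) +
    p n' false * expect p n' X (upd a n' false)
  else X a.

Lemma updC a x b y c : x != y -> upd (upd a x b) y c = upd (upd a y c) x b.
Proof.
move=> xy; apply/funext => z; rewrite /upd.
by case: (eqVneq z y) => [->|//]; rewrite eq_sym (negPf xy).
Qed.

Lemma upd_upd a x b c : upd (upd a x b) x c = upd a x c.
Proof. by apply/funext => z; rewrite /upd; case: eqP. Qed.

Section Expectation.
Variables (R : realFieldType) (p : nat -> bool -> R).
Hypothesis p_ge0 : forall x b, 0 <= p x b.
Hypothesis p_sum : forall x, p x true + p x false = 1.

(** Only variables below [n] are redrawn, so agreement is asked only on assignments that coincide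
    with [a] from [n] on. After a recursion step this makes the value of the variable just drawn
    available. *)
Lemma eq_expect n X Y a : (forall a', (forall y, (n <= y)%N -> a' y = a y) ->
  X a' = Y a') -> expect p n X a = expect p n Y a.
Proof.
elim: n a => [|n IH] a h /=; first exact: h.
have hb b : expect p n X (upd a n b) = expect p n Y (upd a n b).
  apply: IH => a' ha'; apply: h => y ny.
  by rewrite ha' 1?ltnW // /upd gtn_eqF.
by rewrite !hb.
Qed.

Lemma expect_le n X Y a : (forall a', X a' <= Y a') ->
  expect p n X a <= expect p n Y a.
Proof. by move=> h; elim: n a => [|n IH] a //=; apply: lerD; apply: ler_wpM2l. Qed.

Lemma expect_cst n c a : expect p n (fun=> c) a = c.
Proof. by elim: n a => [//|n IH] a /=; rewrite !IH -mulrDl p_sum mul1r. Qed.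

Lemma expectB n X Y a :
  expect p n (fun a' => X a' - Y a') a = expect p n X a - expect p n Y a.
Proof. by elim: n a => [//|n IH] a /=; rewrite !IH; ring. Qed.

Lemma expectZ n c X a : expect p n (fun a' => c * X a') a = c * expect p n X a.
Proof. by elim: n a => [//|n IH] a /=; rewrite !IH; ring. Qed.

Lemma expect_upd n X a x b : (n <= x)%N ->
  expect p n (fun a' => X (upd a' x b)) a = expect p n X (upd a x b).
Proof.
elim: n a => [//|n IH] a nx /=; have nx' : n != x by rewrite ltn_eqF.
by rewrite !IH ?(ltnW nx) // !(updC _ _ _ nx').
Qed.

Lemma expect_var n X a x b : (x < n)%N ->
  expect p n (fun a' => (a' x == b)%:R * X a') a =
  p x b * expect p n (fun a' => X (upd a' x b)) a.
Proof.
elim: n a => [//|n IH] a; rewrite ltnS leq_eqVlt => /orP[/eqP->|xn] /=.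
  have hb c : expect p n (fun a' => (a' n == b)%:R * X a') (upd a n c) =
      (c == b)%:R * expect p n X (upd a n c).
    rewrite -expectZ; apply: eq_expect => a' /(_ n (leqnn n)) ->.
    by rewrite /upd eqxx.
  rewrite !hb !expect_upd // !upd_upd -mulrDl p_sum mul1r.
  by case: b {hb IH}; rewrite /= ?mul1r ?mul0r ?mulr0 ?addr0 ?add0r.
by rewrite !IH //; ring.
Qed.

Definition violation_prob (C : clause) : R := \prod_(l <- C) p l.1 (~~ l.2).

Lemma clause_holds_upd a C x b : x \notin unzip1 C ->
  clause_holds (upd a x b) C = clause_holds a C.
Proof.
move=> xC; apply: eq_in_has => l lC; rewrite /upd; case: (l.1 =P x) => // e.
by case/negP: xC; rewrite -e; apply: map_f.
Qed.

(** Falsifying a literal of [C] never increases [X], so the violation of [C] and [X] are negatively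
    correlated. The literals are treated one at a time, each step conditioning on one variable. *)
Lemma expect_violated n C X a :
  uniq (unzip1 C) -> all (fun l => l.1 < n)%N C ->
  (forall a', 0 <= X a') ->
  (forall a' l, l \in C -> X (upd a' l.1 (~~ l.2)) <= X a') ->
  expect p n (fun a' => (~~ clause_holds a' C)%:R * X a') a <=
    violation_prob C * expect p n X a.
Proof.
rewrite /violation_prob; elim: C => [|[x b] C IH] /=.
  by move=> _ _ X0 _; rewrite big_nil mul1r; apply: expect_le => a'; rewrite mul1r.
move=> /andP[xC uC] /andP[xn nC] X0 mono; rewrite big_cons -mulrA /=.
have -> : expect p n (fun a' => (~~ ((a' x == b) || clause_holds a' C))%:R * X a') a =
    expect p n (fun a' => (a' x == ~~ b)%:R * ((~~ clause_holds a' C)%:R * X a')) a.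
  apply: eq_expect => a' _; rewrite negb_or mulrA -natrM mulnb.
  by case: (a' x); case: b {mono}.
rewrite expect_var //; apply: ler_wpM2l => //.
apply: le_trans (IH uC nC X0 _); last by move=> a' l lC; apply: mono; rewrite inE lC orbT.
apply: expect_le => a'; rewrite clause_holds_upd // ler_wpM2l //.
by apply: (mono a' (x, b)); rewrite inE eqxx.
Qed.

(** The lopsided notion of neighbour: clauses that merely share literals of equal sign do not
    count. *)
Definition conflicts (C D : clause) : bool := has (fun l => flip_lit l \in D) C.

(** Making [l] false can turn a false clause true only through the literal [flip_lit l]. *)
Lemma clause_holds_falsify a D l : flip_lit l \notin D ->
  clause_holds (upd a l.1 (~~ l.2)) D -> clause_holds a D.
Proof.
move=> lD /hasP[[x b] xD]; rewrite /upd /=; case: (x =P l.1) => [e|_] h.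
  by move: lD; rewrite /flip_lit (eqP h) -e xD.
by apply/hasP; exists (x, b).
Qed.

Definition sat_prob (n : nat) (S : formula) (a : nat -> bool) : R :=
  expect p n (fun a' => (all (clause_holds a') S)%:R) a.

Variables (n : nat) (F : formula) (y : R) (a0 : nat -> bool).
Hypothesis uniq_vars : forall C, C \in F -> uniq (unzip1 C).
Hypothesis lt_vars : forall C, C \in F -> all (fun l => l.1 < n)%N C.
Hypothesis y_gt0 : 0 < y.
Hypothesis y_le1 : y <= 1.
Hypothesis violation_bound : forall C, C \in F ->
  violation_prob C <= (1 - y) * y ^+ count (conflicts C) F.

Lemma sat_prob_cons C S : sat_prob n (C :: S) a0 = sat_prob n S a0 -
  expect p n (fun a => (~~ clause_holds a C)%:R * (all (clause_holds a) S)%:R) a0.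
Proof.
rewrite /sat_prob -expectB; apply: eq_expect => a _ /=.
by case: (clause_holds a C); rewrite ?mul0r ?subr0 ?mul1r ?subrr.
Qed.

Lemma expect_ge0 X : (forall a, 0 <= X a) -> 0 <= expect p n X a0.
Proof. by move=> X0; rewrite -(expect_cst n 0 a0); apply: expect_le. Qed.

(* [S] ranges over the submultisets of [F]: the bound on the counts of all
   predicates includes that on the number of clauses in conflict with [C]. *)
Lemma local_lemma_step C S : C \in F ->
  (forall P : pred clause, count P S <= count P F)%N ->
  expect p n (fun a => (~~ clause_holds a C)%:R * (all (clause_holds a) S)%:R) a0
    <= (1 - y) * sat_prob n S a0.
Proof.
have [m] := ubnP (size S); elim: m S C => // m IH S C Sm CF dom.
set S1 := seq.filter (conflicts C) S; set S2 := seq.filter (predC (conflicts C)) S.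
have permS : perm_eq (S1 ++ S2) S by rewrite perm_filterC.
have allS a : all (clause_holds a) S = all (clause_holds a) (S1 ++ S2).
  by rewrite (perm_all _ permS).
have domS (P : pred clause) : (count P (S1 ++ S2) <= count P F)%N.
  by rewrite (permP permS).
have szS : size (S1 ++ S2) = size S.
  exact: perm_size.
have Z0 : 0 <= sat_prob n S2 a0 by apply: expect_ge0.
(* By the induction hypothesis each clause of [T] is violated with conditional probability at most
   [1 - y], so adding it keeps at least a fraction [y]. *)
have chain T : (size (T ++ S2) <= m)%N -> (forall P : pred clause, count P (T ++ S2) <= count P F)%N ->
    y ^+ size T * sat_prob n S2 a0 <= sat_prob n (T ++ S2) a0.
  elim: T => [|D T IHT] szT domT; first by rewrite mul1r.
  have domT' (P : pred clause) : (count P (T ++ S2) <= count P F)%N.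
    by apply: leq_trans (domT P); apply: leq_addl.
  have DF : D \in F.
    by rewrite -has_pred1 has_count; apply: leq_trans (domT _); rewrite /= eqxx.
  rewrite cat_cons sat_prob_cons exprS -mulrA.
  have h1 := IH (T ++ S2) D szT DF domT'.
  have h2 := IHT (ltnW szT) domT'.
  have h3 := ler_wpM2l (ltW y_gt0) h2.
  by lra.
(* The clauses of [S1] are dropped. Falsifying a literal of [C] cannot turn a false clause of [S2]
   true, so [expect_violated] applies. *)
apply: (@le_trans _ _ (violation_prob C * sat_prob n S2 a0)).
  apply: le_trans (expect_violated _ (uniq_vars CF) (lt_vars CF) _ _) => //.
    apply: expect_le => a; rewrite allS all_cat ler_wpM2l // ler_nat.
    by case: (all _ S2); rewrite ?andbF ?leq_b1.
  move=> a l lC; rewrite ler_nat.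
  case e: (all (clause_holds (upd _ _ _)) S2) => //.
  suff -> : all (clause_holds a) S2 by [].
  apply/allP => D DS2; move/allP/(_ D DS2): e; apply: clause_holds_falsify.
  move: DS2; rewrite mem_filter => /andP[/hasPn/(_ l lC)].
  by [].
have -> : sat_prob n S a0 = sat_prob n (S1 ++ S2) a0.
  by apply: eq_expect => a _; rewrite allS.
apply: le_trans (ler_wpM2r Z0 (violation_bound CF)) _.
rewrite -mulrA ler_wpM2l ?subr_ge0 //.
apply: le_trans (chain S1 _ domS); last by rewrite szS.
rewrite ler_wpM2r // ler_wiXn2l // ?(ltW y_gt0) //.
by rewrite size_filter.
Qed.

(** Each added clause keeps at least a fraction [y] of the probability, which stays positive; an
    unsatisfiable [F] would have probability 0. *)
Lemma lopsided_local_lemma : satisfiable F.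
Proof.
have pos S : (forall P : pred clause, count P S <= count P F)%N ->
    0 < sat_prob n S a0.
  elim: S => [|C S IH] dom; first by rewrite /sat_prob expect_cst.
  have dom' (P : pred clause) : (count P S <= count P F)%N.
    by apply: leq_trans (dom P); apply: leq_addl.
  have CF : C \in F.
    by rewrite -has_pred1 has_count; apply: leq_trans (dom _); rewrite /= eqxx.
  have h1 := local_lemma_step CF dom'; rewrite sat_prob_cons.
  have h2 : 0 < y * sat_prob n S a0 by rewrite mulr_gt0 // IH.
  by lra.
have := pos F (fun=> leqnn _); apply: contraPP => nsat; rewrite /sat_prob.
rewrite (eq_expect (Y := fun=> 0)) ?expect_cst ?ltxx // => a _.
by case e: (all _ _) => //; case: nsat; exists a.
Qed.

End Expectation.
(** * Formulas from binary trees *)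

Inductive tree : Type := Leaf | Node (t u : tree).

(* The address of a node lists the turns from the node up to the root; the
   variable of a node is the code of its address. *)
Fixpoint leaves (t : tree) (p : seq bool) : seq (seq bool) :=
  match t with
  | Leaf => [:: p]
  | Node t u => leaves t (true :: p) ++ leaves u (false :: p)
  end.

(** Each literal is false exactly when the assignment takes the turn [b] at that ancestor, hence the
    negation. *)
Fixpoint leaf_clause (k : nat) (p : seq bool) : clause :=
  match k, p with
  | k'.+1, b :: p' => (pickle p', ~~ b) :: leaf_clause k' p'
  | _, _ => [::]
  end.

Definition tree_formula (k : nat) (t : tree) : formula :=
  [seq leaf_clause k p | p <- leaves t [::]].

Fixpoint deep (t : tree) (d : nat) : bool :=
  match t with
  | Leaf => d == 0%N
  | Node t u => deep t d.-1 && deep u d.-1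
  end.

Fixpoint near_leaves (t : tree) (d : nat) : nat :=
  match t, d with
  | Leaf, _ => 1%N
  | Node _ _, 0%N => 0%N
  | Node t u, d'.+1 => (near_leaves t d' + near_leaves u d')%N
  end.

Fixpoint sparse (k s : nat) (t : tree) : bool :=
  match t with
  | Leaf => true
  | Node t' u' =>
      [&& (near_leaves t k <= s)%N, sparse k s t' & sparse k s u']
  end.

Lemma size_leaf_clause k p : size (leaf_clause k p) = minn k (size p).
Proof.
by elim: k p => [|k IH] [|b p] //=; rewrite ?min0n ?minn0 // IH minnSS.
Qed.

Lemma var_in_leaf_clause k p x :
  var_in x (leaf_clause k p) ->
  exists u p', [/\ p = u ++ p', (0 < size u <= k)%N & x = pickle p'].
Proof.
elim: k p => [|k IH] [|b p] //= /orP[/eqP/= <-|].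
  by exists [:: b], p.
move=> /IH[u [p' [-> /andP[u0 uk] ->]]].
by exists (b :: u), p'; split.
Qed.

Lemma uniq_leaf_clause k p : uniq (leaf_clause k p).
Proof.
elim: k p => [|k IH] [|b p] //=; rewrite IH andbT; apply/negP => pin.
have /var_in_leaf_clause[u [p' [e /andP[u0 _] /(pcan_inj pickleK)]]] :
    var_in (pickle p) (leaf_clause k p).
  by apply/hasP; exists (pickle p, ~~ b).
move=> ep; move: e u0; rewrite -ep => /(congr1 size).
by rewrite size_cat; case: (size u) => // n; lia.
Qed.

Lemma deepW t d d' : (d <= d')%N -> deep t d' -> deep t d.
Proof.
elim: t d d' => [|t IHt u IHu] d d' /=; first lia.
move=> dd' /andP[h1 h2]; have le1 : (d.-1 <= d'.-1)%N by lia.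
by rewrite (IHt _ _ le1 h1) (IHu _ _ le1 h2).
Qed.

Lemma deep_leaves t d p0 :
  deep t d -> all (fun p => (d + size p0 <= size p)%N) (leaves t p0).
Proof.
elim: t d p0 => [|t IHt u IHu] d p0 /=; first by rewrite andbT => /eqP->.
rewrite all_cat => /andP[/(IHt _ (true :: p0)) h1 /(IHu _ (false :: p0)) h2].
by apply/andP; split; [apply: sub_all h1|apply: sub_all h2] => p /=; lia.
Qed.

(** Following at each node the turn given by the assignment leads to a leaf whose clause is
    violated. *)
Lemma tree_formula_unsat k t : ~ satisfiable (tree_formula k t).
Proof.
move=> [a /allP sat].
suff [p pin nholds] : exists2 p, p \in leaves t [::] &
    ~~ clause_holds a (leaf_clause k p).
  by move: nholds; rewrite sat //; apply: map_f.
clear sat.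
have : forall n, ~~ clause_holds a (leaf_clause n [::]) by case.
move: [::] => p0; elim: t p0 => [|t IHt u IHu] p0 h /=.
  by exists p0; rewrite ?inE.
have step b : a (pickle p0) = b ->
    forall n, ~~ clause_holds a (leaf_clause n (b :: p0)).
  by move=> e [|n] //=; rewrite negb_or e h andbT; case: (b).
case e: (a (pickle p0)).
  by have [p pin np] := IHt _ (step _ e); exists p; rewrite // mem_cat pin.
by have [p pin np] := IHu _ (step _ e); exists p; rewrite // mem_cat pin orbT.
Qed.

Definition var_count (k : nat) (x : nat) (ps : seq (seq bool)) : nat :=
  count (fun p => var_in x (leaf_clause k p)) ps.

(** The node [p'] lies [size u] levels above the root of [t], so only leaves of [t] within the
    remaining distance can mention it. *)
Lemma var_count_ancestor k t u p' :
  (var_count k (pickle p') (leaves t (u ++ p'))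
     <= if (size u <= k)%N then near_leaves t (k - size u) else 0)%N.
Proof.
elim: t u => [|t IHt t' IHt'] u /=.
  rewrite /var_count /= addn0; case: ifPn => [_|]; first by case: (var_in _ _).
  move=> nle; case e: (var_in _ _) => //.
  have [v [p [/(congr1 size)]]] := var_in_leaf_clause e.
  by move=> + + /(pcan_inj pickleK) pp; rewrite -pp !size_cat; lia.
rewrite /var_count count_cat.
have := leq_add (IHt (true :: u)) (IHt' (false :: u)).
move=> /leq_trans; apply => /=.
have [uk|uk] := ltnP (size u) k; last by case: ifP.
by rewrite (ltnW uk) (_ : k - size u = (k - (size u).+1).+1)%N //; lia.
Qed.

Lemma leaves_suffix t p0 p : p \in leaves t p0 -> exists u, p = u ++ p0.
Proof.
elim: t p0 => [|t IHt u IHu] p0 /=; first by rewrite inE => /eqP->; exists [::].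
by rewrite mem_cat => /orP[/IHt|/IHu] [v ->];
  [exists (rcons v true)|exists (rcons v false)]; rewrite cat_rcons.
Qed.

(** The second hypothesis says that [p'] is not a proper ancestor of the root of [t]. Either it is
    this root and [var_count_ancestor] applies, or at most one of the two subtrees contains it and
    the other contributes nothing. *)
Lemma var_count_sparse k s t p0 p' : sparse k s t ->
  (forall u, p0 = u ++ p' -> u = [::]) ->
  (var_count k (pickle p') (leaves t p0) <= s)%N.
Proof.
elim: t p0 => [|t IHt u IHu] p0 => [_|].
  move=> hp; rewrite /var_count /=; case e: (var_in _ _) => //.
  have [v [p [+ /andP[v0 _] /(pcan_inj pickleK) pp]]] := var_in_leaf_clause e.
  by rewrite -pp => /hp ve; rewrite ve in v0.
move=> /and3P[nk st su] hp.
have [->|neq] := eqVneq p' p0.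
  have := var_count_ancestor k (Node t u) [::] p0.
  by rewrite /= subn0 => /leq_trans; apply.
have hb b v : b :: p0 = v ++ p' -> v = [::].
  case: v => //= c v [_] pv; have v0 := hp _ pv.
  by move: neq; rewrite pv v0 eqxx.
(* The address of a leaf that mentions [p'] ends both in [p'] and in [b :: p0]; comparing lengths
   places [p'] inside this subtree. *)
have sub w b : var_count k (pickle p') (leaves w (b :: p0)) != 0%N ->
    exists v, p' = v ++ b :: p0.
  rewrite -lt0n -has_count => /hasP[p /leaves_suffix[v ->]].
  move=> /var_in_leaf_clause[z [p1 [pz _ /(pcan_inj pickleK) pp]]].
  rewrite -{}pp in pz.
  have [le|lt] := leqP (size z) (size v).
    exists (drop (size z) v); have := congr1 (drop (size z)) pz.
    rewrite [X in _ = X]drop_size_cat // drop_cat.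
    by case: ltngtP le => // -> _; rewrite subnn drop0 drop_size.
  have := congr1 (drop (size v)) pz.
  rewrite drop_size_cat // drop_cat lt => /hb /(congr1 size).
  by rewrite size_drop /=; lia.
rewrite /= /var_count count_cat.
have [e|/sub[v ev]] := eqVneq (var_count k (pickle p') (leaves t (true :: p0))) 0%N.
  by rewrite -/(var_count _ _ _) e add0n; apply: (IHu _ su (hb _)).
have [e|/sub[v' ev']] := eqVneq (var_count k (pickle p') (leaves u (false :: p0))) 0%N.
  rewrite -/(var_count _ _ _) -[X in (_ + X)%N]/(var_count _ _ _) e addn0.
  exact: (IHt _ st (hb _)).
have vv : size v = size v'.
  by have := congr1 size ev; rewrite ev' !size_cat /=; lia.
by move: ev; rewrite ev' => /eqP; rewrite eqseq_cat // eqseq_cons /= andbF.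
Qed.

Lemma tree_formula_ks_cnf k s t :
  deep t k -> sparse k s t -> ks_cnf k s (tree_formula k t).
Proof.
move=> /(@deep_leaves _ _ [::]) dt st; split=> [|x].
  rewrite /k_cnf all_map; apply: sub_all dt => p /=; rewrite addn0 => kp.
  by rewrite uniq_leaf_clause size_leaf_clause (minn_idPl kp) eqxx.
rewrite count_map; have [/hasP[p _]|] := boolP (has (preim (leaf_clause k) (var_in x)) (leaves t [::])).
  move=> /var_in_leaf_clause[u [p' [_ _ ->]]].
  by apply: var_count_sparse st _ => -[].
by rewrite has_count -leqNgt leqn0 => /eqP->.
Qed.

Lemma f_lt_sparse k s t :
  (0 < k)%N -> deep t k -> sparse k s t -> (f k < s)%N.
Proof.
move=> k0 dt st; rewrite ltnNge; apply/negP => sf.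
have [sat _] := fP k0; have [kF cF] := tree_formula_ks_cnf dt st.
apply: (@tree_formula_unsat k t); apply: sat; split=> // x.
exact: leq_trans (cF x) sf.
Qed.

(** * Complete trees, gluing, growing and rounds *)

Fixpoint full (i : nat) : tree :=
  if i is i'.+1 then Node (full i') (full i') else Leaf.

Fixpoint comb (i : nat) (sub : nat -> tree) : tree :=
  if i is i'.+1
  then Node (comb i' sub) (comb i' (fun j => sub (2 ^ i' + j)%N))
  else sub 0%N.

(** Passes from [k] to [k.+1] while doubling [s], which reaches the values of [k] that are not
    multiples of [r]. *)
Fixpoint grow (t : tree) : tree :=
  match t with
  | Leaf => Node Leaf Leaf
  | Node t u => Node (grow t) (grow u)
  end.

Lemma near_leaves_full i d :
  near_leaves (full i) d = if (i <= d)%N then (2 ^ i)%N else 0%N.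
Proof.
elim: i d => [|i IH] [|d] //=.
by rewrite IH ltnS addnn -mul2n expnS; case: ifP => //; rewrite muln0.
Qed.

Lemma near_leaves_full_le i d : (near_leaves (full i) d <= 2 ^ i)%N.
Proof. by rewrite near_leaves_full; case: ifP. Qed.

Lemma sparse_full k s i : (2 ^ i <= s)%N -> sparse k s (full i).
Proof.
elim: i => // i IH le; have le' : (2 ^ i <= s)%N.
  by apply: leq_trans le; rewrite leq_exp2l.
by rewrite /= IH // andbT (leq_trans (near_leaves_full_le i.+1 k)).
Qed.

Lemma near_leaves_comb i d sub :
  near_leaves (comb i sub) (i + d) = (\sum_(0 <= j < 2 ^ i) near_leaves (sub j) d)%N.
Proof.
elim: i sub => [|i IH] sub; first by rewrite big_nat1.
rewrite addSn /= !IH expnS mul2n -addnn.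
rewrite [RHS](@big_cat_nat _ _ _ (2 ^ i)%N) ?leq_addr//=.
congr (_ + _)%N; rewrite [RHS](big_addn 0%N _ (2 ^ i)%N) addnK.
by apply: eq_bigr => j _; rewrite addnC.
Qed.

Lemma near_leaves_comb0 i d sub : (d < i)%N -> near_leaves (comb i sub) d = 0%N.
Proof. by elim: i d sub => // i IH [|d] sub //= di; rewrite !IH. Qed.

(** A node [h] levels above the subtrees sees [2 ^ h] of them, so it is enough that each contributes
    at most [s / 2 ^ h]. *)
Lemma sparse_comb k s i sub :
  (forall j, (j < 2 ^ i)%N -> sparse k s (sub j)) ->
  (forall h j, (0 < h <= i)%N -> (j < 2 ^ i)%N ->
     (2 ^ h * near_leaves (sub j) (k - h) <= s)%N) ->
  sparse k s (comb i sub).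
Proof.
elim: i sub => [|i IH] sub hs hn; first exact: hs.
have e : (2 ^ i.+1 = 2 ^ i + 2 ^ i)%N by rewrite expnS mul2n addnn.
have hl j : (j < 2 ^ i)%N -> (j < 2 ^ i.+1)%N by rewrite e; lia.
have hr j : (j < 2 ^ i)%N -> (2 ^ i + j < 2 ^ i.+1)%N by rewrite e; lia.
apply/and3P; split; last first.
- apply: IH => [j /hr/hs //|h j /andP[h0 hi] /hr].
  by apply: hn; rewrite h0 leqW.
- apply: IH => [j /hl/hs //|h j /andP[h0 hi] /hl].
  by apply: hn; rewrite h0 leqW.
change (near_leaves (comb i.+1 sub) k <= s)%N.
have [ki|ik] := ltnP k i.+1; first by rewrite near_leaves_comb0.
rewrite -(subnKC ik) near_leaves_comb -(leq_pmul2l (expn_gt0 2 i.+1)).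
rewrite big_distrr /=.
apply: (@leq_trans (\sum_(0 <= j < 2 ^ i.+1) s)); last by rewrite sum_nat_const_nat subn0.
rewrite big_nat_cond [leqRHS]big_nat_cond; apply: leq_sum => j; rewrite andbT => /= jlt.
by apply: hn; rewrite ?leqnn.
Qed.

Lemma deep_comb i d sub :
  (forall j, (j < 2 ^ i)%N -> deep (sub j) d) -> deep (comb i sub) (i + d).
Proof.
elim: i sub => [|i IH] sub hs; first exact: hs.
have e : (2 ^ i.+1 = 2 ^ i + 2 ^ i)%N by rewrite expnS mul2n addnn.
by rewrite addSn /= !IH // => j jlt; apply: hs; rewrite e; lia.
Qed.

Lemma near_leaves_grow t d : near_leaves (grow t) d.+1 = (2 * near_leaves t d)%N.
Proof. by elim: t d => [|t IHt u IHu] [|d] //; rewrite /= ?IHt ?IHu; [case: t {IHt}; case: u {IHu}|lia]. Qed.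

Lemma sparse_grow k s t : (0 < k)%N -> (0 < s)%N ->
  sparse k s t -> sparse k.+1 (2 * s) (grow t).
Proof.
move=> k0 s0; elim: t => [_|t IHt u IHu /and3P[nk ht hu]].
  by case: k k0 => // k _ /=; lia.
apply/and3P; split; [|exact: IHt|exact: IHu].
by rewrite (near_leaves_grow (Node t u)) leq_mul2l nk orbT.
Qed.

Lemma deep_grow t d : deep t d -> deep (grow t) d.+1.
Proof.
elim: t d => [|t IHt u IHu] d /=; first by move=> /eqP->.
case: d => [|d] /andP[/IHt h1 /IHu h2] /=; last by rewrite h1 h2.
by rewrite (deepW _ h1) // (deepW _ h2).
Qed.

(** Here [n] is the index of the round and [m] the number of rounds after it. The remainder [j %% r]
    gives each height below [r] equally often. The last [Leaf] is a default, not reached when the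
    last round closes everything. *)
Fixpoint round_tree (r : nat) (w : nat -> nat) (m n : nat) : tree :=
  comb r (fun j =>
    if (j < r * w n)%N then full (j %% r)
    else if m is m'.+1 then round_tree r w m' n.+1 else Leaf).

(* With [truncated] subtraction, [free r w n = 0] in the last round. *)
Definition free (r : nat) (w : nat -> nat) (n : nat) : nat := (2 ^ r - r * w n)%N.

(** For [m <= n], the number of subtrees entering round [n] below one that enters round [n - m]. For
    larger [m], truncated subtraction repeats the factor of round 0. *)
Definition free_prod (r : nat) (w : nat -> nat) (n m : nat) : nat :=
  (\prod_(l < m) free r w (n - l.+1))%N.

Lemma free_prodSS r w n m :
  free_prod r w n.+1 m.+1 = (free r w n * free_prod r w n m)%N.
Proof. by rewrite /free_prod big_ord_recl subn1. Qed.

Lemma free_prodD r w n m m' :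
  free_prod r w n (m + m') = (free_prod r w n m * free_prod r w (n - m) m')%N.
Proof.
rewrite /free_prod big_split_ord /=; congr (_ * _)%N.
by apply: eq_bigr => i _; rewrite -subnDA addnS.
Qed.

Lemma sum_pow2 n : (\sum_(i < n) 2 ^ i = 2 ^ n - 1)%N.
Proof. by rewrite subn1 predn_exp mul1n. Qed.

Lemma sum_modn r c (F : nat -> nat) :
  (\sum_(0 <= j < r * c) F (j %% r) = c * \sum_(i < r) F i)%N.
Proof.
elim: c => [|c IH]; first by rewrite muln0 big_geq.
rewrite mulnS addnC (@big_cat_nat _ _ _ (r * c)) ?leq_addr //= IH mulSn addnC.
congr (_ + _)%N; rewrite (big_addn 0%N _ (r * c)%N) addKn big_mkord.
by apply: eq_bigr => i _; rewrite [(r * c)%N]mulnC addnC modnMDl modn_small.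
Qed.

Lemma sum_near_leaves_full r c d :
  (\sum_(0 <= j < r * c) near_leaves (full (j %% r)) d <= c * (2 ^ minn r d.+1 - 1))%N.
Proof.
rewrite (sum_modn _ _ (fun i => near_leaves (full i) d)) leq_mul2l; apply/orP; right.
rewrite (eq_bigr (fun i : 'I_r => if (i < d.+1)%N then 2 ^ i else 0))%N; last first.
  by move=> i _; rewrite near_leaves_full.
rewrite -big_mkcond /= -sum_pow2.
have [le|lt] := leqP r d.+1.
  by rewrite (eq_bigl xpredT)// => i; rewrite (leq_trans (ltn_ord i) le).
by rewrite (big_ord_widen r (fun i => 2 ^ i)%N (ltnW lt)).
Qed.

Lemma near_leaves_round r w m n d : (r * w (n + m) >= 2 ^ r)%N ->
  (near_leaves (round_tree r w m n) (r + d) <=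
   w n * (2 ^ minn r d.+1 - 1) +
   (if m is m'.+1 then free r w n * near_leaves (round_tree r w m' n.+1) d else 0))%N.
Proof.
move=> last; set S := (if m is _.+1 then _ else _).
have -> : round_tree r w m n = comb r (fun j => if (j < r * w n)%N then full (j %% r)
    else if m is m'.+1 then round_tree r w m' n.+1 else Leaf) by case: (m).
rewrite near_leaves_comb.
have [le|lt] := leqP (2 ^ r) (r * w n).
  (* All [2 ^ r] subtrees are closed here; letting the sum run up to [r * w n] only enlarges it. *)
  apply: leq_trans (leq_addr _ _).
  apply: leq_trans (sum_near_leaves_full r (w n) d).
  rewrite [leqRHS](@big_cat_nat _ _ _ (2 ^ r)%N) //=.
  apply: leq_trans (leq_addr _ _); rewrite big_nat [leqRHS]big_nat.
  by apply: leq_sum => j /andP[_ jr]; rewrite (leq_trans jr le).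
rewrite (@big_cat_nat _ _ _ (r * w n)) ?(ltnW lt)//=; apply: leq_add.
  apply: leq_trans (sum_near_leaves_full r (w n) d).
  rewrite big_nat [leqRHS]big_nat.
  by apply: leq_sum => j /andP[_ ->].
rewrite /S; case: m last {S} => [|m] last; first by move: last; rewrite addn0 leqNgt lt.
rewrite /free -sum_nat_const_nat big_nat [leqRHS]big_nat.
by apply: leq_sum => j /andP[jr _]; rewrite ltnNge jr.
Qed.

Lemma free_prod_ge r w L a n m : (0 < L)%N -> (n <= L)%N ->
  (forall i, (i < L)%N -> (a <= free r w i)%N) -> (a ^ m <= free_prod r w n m)%N.
Proof.
move=> L0 nL ha; rewrite /free_prod -[X in (a ^ X)%N]card_ord -prod_nat_const.
by apply: leq_prod => i _; apply: ha; lia.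
Qed.

Lemma sum_geometric (R : realFieldType) (a : R) (J : nat) : 1 < a ->
  \sum_(i < J) a ^- i.+1 <= (a - 1)^-1.
Proof.
move=> a1; have a0 : 0 < a by lra.
suff -> : \sum_(i < J) a ^- i.+1 = (1 - a ^- J) / (a - 1).
  rewrite ler_pdivrMr ?subr_gt0// mulVf; last by rewrite gt_eqF ?subr_gt0.
  by rewrite gerBl invr_ge0 exprn_ge0 // ltW.
elim: J => [|J IH]; first by rewrite big_ord0 expr0 invr1 subrr mul0r.
rewrite big_ord_recr /= IH exprS invfM.
by field; rewrite expf_neq0 ?gt_eqF ?subr_gt0.
Qed.

(* The weight [free_prod] turns the number of leaves below one node of round
   [n] into the number of leaves below a whole level of round [n - (q - J)]. *)
Lemma near_leaves_round_bound (R : realFieldType) (r q L a : nat)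
    (w : nat -> nat) (K : R) (m n J e : nat) :
  (forall i, (w i * free_prod r w i q)%:R <= K) ->
  (0 < L)%N -> (forall i, (i < L)%N -> (a <= free r w i)%N) -> (0 < a)%N ->
  (2 ^ r <= r * w L)%N ->
  (n + m = L)%N -> (e < r)%N -> (J <= q)%N ->
  (near_leaves (round_tree r w m n) (J * r + r + e) * free_prod r w n (q - J))%:R
    <= K * (2 ^+ e.+1 - 1 + (2 ^+ r - 1) * \sum_(i < J) a%:R ^- i.+1).
Proof.
move=> hK L0 ha a0 hL; elim: J m n => [|J IH] m n nm er Jq.
  rewrite big_ord0 mulr0 addr0 mul0n add0n subn0.
  have near : (near_leaves (round_tree r w m n) (r + e) <= w n * (2 ^ e.+1 - 1))%N.
    apply: leq_trans (near_leaves_round _ _) _; first by rewrite nm.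
    rewrite (minn_idPr er); case: (m) => [|m']; first by rewrite addn0.
    (* The next round opens with [r] levels free of leaves, and [e < r]. *)
    suff -> : near_leaves (round_tree r w m' n.+1) e = 0%N by rewrite muln0 addn0.
    by case: m' => [|m'] /=; apply: near_leaves_comb0.
  have le : (near_leaves (round_tree r w m n) (r + e) * free_prod r w n q <=
      w n * free_prod r w n q * (2 ^ e.+1 - 1))%N.
    by rewrite mulnAC leq_mul2r near orbT.
  apply: (le_trans (_ : _ <= (w n * free_prod r w n q * (2 ^ e.+1 - 1))%:R)).
    by rewrite ler_nat.
  rewrite [X in X <= _]natrM natrB ?expn_gt0// natrX ler_wpM2r//.
  by rewrite subr_ge0 -natrX ler1n expn_gt0.
have Q1 : 0 <= 2 ^+ r - 1 :> R by rewrite subr_ge0 -natrX ler1n expn_gt0.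
have -> : (J.+1 * r + r + e = r + (J * r + r + e))%N by rewrite mulSn; lia.
rewrite big_ord_recr /= (mulrDr (2 ^+ r - 1)) addrA (mulrDr K) [leRHS]addrC.
set d := (J * r + r + e)%N; set p := free_prod r w n _.
have hnear := @near_leaves_round r w m n d; rewrite nm in hnear.
have {}hnear := hnear hL.
set S := (if m is _.+1 then _ else _) in hnear.
apply: (le_trans (_ : _ <= ((w n * p)%:R * (2 ^+ r - 1) + (S * p)%:R))).
  rewrite -natrX -(natrB _ (expn_gt0 2 r)) -natrM -natrD ler_nat.
  apply: leq_trans (leq_mul hnear (leqnn p)) _; rewrite mulnDl leq_add2r mulnAC.
  by rewrite leq_mul2l leq_sub2r ?orbT // leq_exp2l // geq_minl.
apply: lerD.
  (* Compared with the product over [q] rounds, [J.+1] factors are missing, each at least [a]. *)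
  rewrite mulrCA [leLHS]mulrC ler_wpM2l //.
  rewrite ler_pdivlMr ?exprn_gt0 ?ltr0n//; apply: le_trans (hK n).
  rewrite -natrX -natrM ler_nat -mulnA leq_mul2l; apply/orP; right.
  rewrite -[X in free_prod r w n X](subnK Jq) free_prodD leq_mul2l; apply/orP; right.
  apply: free_prod_ge L0 _ ha; apply: leq_trans (leq_subr _ _) _.
  by rewrite -nm leq_addr.
(* For positive [m], the factor [free r w n] is absorbed into the weight of round [n.+1]. *)
have -> : (S * p)%:R = ((if m is m'.+1 then near_leaves (round_tree r w m' n.+1) d else 0) *
   free_prod r w n.+1 (q - J))%:R :> R.
  rewrite /S /p (_ : q - J = (q - J.+1).+1)%N; last by rewrite subnSK.
  case: (m) => [|m']; first by rewrite !mul0n.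
  by rewrite free_prodSS mulnCA mulnA.
case: m nm {hnear S} => [|m] nm.
  rewrite mul0n mulr_ge0 //; first exact: le_trans (hK 0%N).
  apply: addr_ge0; first by rewrite subr_ge0 -natrX ler1n expn_gt0.
  by rewrite mulr_ge0 // sumr_ge0 // => i _; rewrite invr_ge0 exprn_ge0.
by apply: IH; rewrite // ?addSnnS // ltnW.
Qed.

(** Closed subtrees contribute at most [2 ^ r * 2 ^ r], even with the factor [2 ^ h] of
    [sparse_comb]. Open ones are handled by [near_leaves_round_bound] with [J = q], where the weight
    is an empty product. *)
Lemma sparse_round_tree (R : realFieldType) (r q L a s : nat)
    (w : nat -> nat) (K : R) :
  (forall i, (w i * free_prod r w i q)%:R <= K) ->
  (0 < L)%N -> (forall i, (i < L)%N -> (a <= free r w i)%N) -> (1 < a)%N ->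
  (2 ^ r <= r * w L)%N -> (2 ^ r * 2 ^ r <= s)%N ->
  (forall v, v%:R <= K * (2 ^+ r.+1 + 2 ^+ r * ((2 ^+ r - a%:R) / (a%:R - 1))) ->
     (v <= s)%N) ->
  sparse (q.+2 * r) s (round_tree r w L 0).
Proof.
move=> hK L0 ha a1 hL Qs hs.
have : (0 + L = L)%N by []; move: {1 3}L 0%N => m n; elim: m n => [|m IH] n nm.
all: apply: sparse_comb => [j jr|h j /andP[h0 hr] jr]; case: ifPn => [jw|_].
- by apply: sparse_full; apply: leq_trans Qs; rewrite -expnD leq_exp2l //; lia.
- by [].
- apply: leq_trans Qs; apply: leq_mul; first by rewrite leq_exp2l.
  by apply: leq_trans (near_leaves_full_le _ _) _; rewrite leq_exp2l //; lia.
- by apply: leq_trans Qs; rewrite /= muln1 -expnD leq_exp2l //; lia.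
- by apply: sparse_full; apply: leq_trans Qs; rewrite -expnD leq_exp2l //; lia.
- by apply: IH; rewrite addSnnS.
- apply: leq_trans Qs; apply: leq_mul; first by rewrite leq_exp2l.
  by apply: leq_trans (near_leaves_full_le _ _) _; rewrite leq_exp2l //; lia.
apply: hs.
have nm' : (n.+1 + m = L)%N by rewrite addSnnS.
have er : (r - h < r)%N by lia.
have := near_leaves_round_bound hK L0 ha (ltnW a1) hL nm' er (leqnn q).
rewrite subnn [free_prod _ _ _ 0]/free_prod big_ord0 muln1.
rewrite (_ : q * r + r + (r - h) = q.+2 * r - h)%N; last by rewrite !mulSn; lia.
have K0 : 0 <= K by exact: le_trans (hK 0%N).
have aR : 1 < a%:R :> R by rewrite ltr1n.
have Q1 : 0 <= 2 ^+ r - 1 :> R by rewrite subr_ge0 -natrX ler1n expn_gt0.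
have aQ : a%:R <= 2 ^+ r :> R.
  by rewrite -natrX ler_nat; apply: leq_trans (ha 0%N L0) (leq_subr _ _).
set v := near_leaves _ _ => hv.
have {}hv : v%:R <= K * (2 ^+ (r - h).+1 - 1 + (2 ^+ r - 1) / (a%:R - 1)).
  by apply: le_trans hv _; rewrite ler_wpM2l // lerD2l ler_wpM2l // sum_geometric.
rewrite natrM natrX.
apply: (le_trans (_ : _ <= 2 ^+ h * (K * (2 ^+ (r - h).+1 - 1 + (2 ^+ r - 1) / (a%:R - 1))))).
  by rewrite ler_wpM2l ?exprn_ge0.
(* Multiplication by [2 ^+ h] turns the main term into [2 ^+ r.+1] for every [h]; only the error
   term still depends on [h]. *)
rewrite mulrCA ler_wpM2l // exprS mulrDr mulrBr mulr1 mulrCA -exprD subnKC // -exprS.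
rewrite -addrA lerD2l.
have -> : - 2 ^+ h + 2 ^+ h * ((2 ^+ r - 1) / (a%:R - 1)) =
   2 ^+ h * ((2 ^+ r - a%:R) / (a%:R - 1)) :> R.
  by field; rewrite subr_eq0 gt_eqF.
apply: ler_wpM2r; last by rewrite ler_eXn2l ?ltr1n.
by rewrite divr_ge0 ?subr_ge0 // ltW.
Qed.

(** Nothing is closed in the rounds 0 to [q], so every branch from round 0 passes the [r] levels of
    each of the rounds 0 to [q.+1]. *)
Lemma deep_round_tree r q w m n :
  (forall i, (i <= q)%N -> w i = 0%N) -> (2 ^ r <= r * w (n + m))%N ->
  deep (round_tree r w m n) (r * (q.+2 - n)).
Proof.
move=> hw; elim: m n => [|m IH] n hL.
all: have wn j : (j < r * w n)%N -> (q < n)%N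
  by move=> jw; rewrite ltnNge; apply/negP => /hw wn0; rewrite wn0 muln0 in jw.
all: have d0 : (q < n)%N -> (r * (q.+2 - n) <= r + 0)%N
  by move=> qn; rewrite addn0 -{2}[r]muln1 leq_mul2l; lia.
  have qn : (q < n)%N.
    by rewrite ltnNge; apply/negP => /hw wn0; rewrite addn0 wn0 muln0 leqNgt expn_gt0 in hL.
  apply: deepW (d0 qn) (deep_comb _) => j jr.
  by case: ifP => // _; apply: deepW (leq0n _) (_ : deep _ (j %% r)); elim: (j %% r)%N => //= i ->.
have [nq|qn] := leqP n q.
  rewrite /= -(subnKC (_ : r <= r * (q.+2 - n)))%N; last by rewrite leq_pmulr //; lia.
  apply: deep_comb => j jr; rewrite ifN; last by apply/negP => /wn; lia.
  rewrite (_ : r * (q.+2 - n) - r = r * (q.+2 - n.+1))%N.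
    by apply: IH; rewrite addSnnS.
  by rewrite -{2}[r]muln1 -mulnBr -subnDA addn1.
apply: deepW (d0 qn) (deep_comb _) => j jr.
case: ifP => _; last by apply: deepW (leq0n _) (IH _ _); rewrite addSnnS.
by apply: deepW (leq0n _) (_ : deep _ (j %% r)); elim: (j %% r)%N => //= i ->.
Qed.

(** * Choice of the parameters *)

(** The exponent 9 = 6 + 3 serves the bound [r ^ 6 <= 2 ^ r %/ r ^ 3]. *)
Lemma pow9_le_exp2 n : (64 <= n)%N -> (n ^ 9 <= 2 ^ n)%N.
Proof.
elim: n => // n IH; rewrite leq_eqVlt => /orP[/eqP<-|].
  by rewrite -[64%N]/(2 ^ 6)%N -expnM leq_exp2l.
rewrite ltnS => n64; rewrite [(2 ^ _)%N]expnS.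
apply: (@leq_trans (2 * n ^ 9)); last by rewrite leq_mul2l IH.
clear IH.
have n2 : (64 * n <= n * n)%N by rewrite leq_mul2r n64 orbT.
have n3 : (64 * (n * n) <= n * (n * n))%N by rewrite leq_mul2r n64 orbT.
(* The ratio 5/4 suffices because its cube is 125/64 < 2. *)
have cube : (4 * n.+1 ^ 3 <= 5 * n ^ 3)%N.
  by rewrite !expnS !expn0; lia.
rewrite -[9%N]/(3 * 3)%N !expnM.
by move: cube; rewrite -(leq_exp2r _ _ (isT : 0 < 3)%N) !expnMn; lia.
Qed.

Lemma subr1X_le_expR (R : realType) (x : R) (q : nat) : x <= 1 ->
  (1 - x) ^+ q <= expR (- (q%:R * x)).
Proof.
move=> x1; rewrite -mulrN expRM_natl; apply: lerXn2r; rewrite ?nnegrE ?expR_ge0 ?subr_ge0 //.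
exact: expR_ge1Dx.
Qed.

Lemma ler_expR_sub1 (R : realType) (x : R) : x <= expR (x - 1).
Proof. by apply: le_trans (expR_ge1Dx _); lra. Qed.

Lemma expR1_ge2 (R : realType) : 2 <= expR 1 :> R.
Proof. by apply: le_trans (expR_ge1Dx _); lra. Qed.

Lemma expR1_le4 (R : realType) : expR 1 <= 4 :> R.
Proof.
have h : 2^-1 <= expR (- 2^-1) :> R by apply: le_trans (expR_ge1Dx _); lra.
have -> : expR 1 = (expR (- 2^-1)) ^- 2 :> R.
  by rewrite -expRM_natl -expRN; congr expR; lra.
rewrite -[leRHS]invrK lef_pV2 ?posrE ?exprn_gt0 ?expR_gt0 ?invr_gt0//.
by apply: le_trans (_ : _ <= 2^-1 ^+ 2) _; [lra | apply: lerXn2r; rewrite ?nnegrE; lra].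
Qed.

(* The maximum over [v] of [v * (Q - r * v) ^+ q] is close to
   [Q ^+ q.+1 / (e * r * q)], since [y <= expR (y - 1)] at [y = q * r * v / Q]. *)
Lemma weight_step (R : realType) (Q r v t : R) (q : nat) :
  0 < Q -> 0 < r -> (0 < q)%N -> 0 < t -> t <= v -> r * v <= Q ->
  (v + 1) * (Q - r * v) ^+ q <= (1 + t^-1) * (Q ^+ q.+1 / (expR 1 * (r * q%:R))).
Proof.
move=> Q0 r0 q0 t0 tv rvQ; have v0 : 0 < v by exact: lt_le_trans tv.
have qR : 0 < q%:R :> R by rewrite ltr0n.
have -> : Q - r * v = Q * (1 - r * v / Q) by field; rewrite gt_eqF.
rewrite exprMn; set x := r * v / Q.
have x1 : x <= 1 by rewrite ler_pdivrMr // mul1r.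
have y : q%:R * x <= expR (q%:R * x) / expR 1.
  by rewrite -expRN -expRD; apply: ler_expR_sub1.
have v1 : v + 1 <= (1 + t^-1) * v.
  by rewrite mulrDl mul1r lerD2l -ler_pdivrMl ?invr_gt0 // invrK mulr1.
have p0 : 0 <= (1 - x) ^+ q by rewrite exprn_ge0 // subr_ge0.
apply: (le_trans (_ : _ <= (1 + t^-1) * v * (Q ^+ q * expR (- (q%:R * x))))).
  apply: ler_pM => //; first by lra.
    by rewrite mulr_ge0 // exprn_ge0 // ltW.
  by rewrite ler_wpM2l ?exprn_ge0 ?(ltW Q0) // subr1X_le_expR.
rewrite -mulrA ler_wpM2l ?addr_ge0 ?invr_ge0 ?(ltW t0) //.
rewrite mulrCA exprSr -[leRHS]mulrA ler_wpM2l ?exprn_ge0 ?(ltW Q0) //.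
rewrite expRN -[v]mulr1 ler_pdivrMr ?expR_gt0 // mulr1.
have -> : v = q%:R * x * (Q / (r * q%:R)) by rewrite /x; field; rewrite !gt_eqF.
apply: le_trans (ler_wpM2r _ y) _; first by rewrite divr_ge0 // ?mulr_ge0 // ltW.
by rewrite le_eqVlt; apply/orP; left; apply/eqP; field; rewrite !gt_eqF ?expR_gt0.
Qed.

(** The weight shared by the [g]-th group of [q.+1] rounds. Starting at [r ^ 2] makes each step by 1
    a relative change of at most [r ^- 2]. The cap keeps the closed fraction [r * w / 2 ^ r] at most
    [r ^- 2], until [2 ^ r] closes everything. *)
Definition group_weight (r g : nat) : nat :=
  if g is g'.+1 then
    if (r ^ 2 + g' <= 2 ^ r %/ r ^ 3)%N then (r ^ 2 + g')%N else (2 ^ r)%N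
  else 0%N.

Lemma leq_group_weight r g : (group_weight r g <= group_weight r g.+1)%N.
Proof.
case: g => [//|g] /=; case: ifP => h1; case: ifP => h2 //; first lia.
  by apply: leq_trans h1 _; apply: leq_div.
by move: h1; rewrite (leq_trans _ h2) // leq_add2l.
Qed.

(** The [q] rounds before round [n] lie in its group or in the preceding one, and the weights are
    monotone. In group 0 the weight vanishes. *)
Lemma group_weight_free_prod r q n :
  (group_weight r (n %/ q.+1) *
     free_prod r (fun i => group_weight r (i %/ q.+1)) n q
   <= group_weight r (n %/ q.+1) *
        (2 ^ r - r * group_weight r (n %/ q.+1).-1) ^ q)%N.
Proof.
case g: (n %/ q.+1)%N => [|h]; first by rewrite mul0n.
rewrite leq_mul2l; apply/orP; right.
rewrite -[X in (_ <= _ ^ X)%N]card_ord -prod_nat_const; apply: leq_prod => i _.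
rewrite leq_sub2l // leq_mul2l; apply/orP; right.
have mono := homo_leq (@leqnn) (@leq_trans) (leq_group_weight r).
apply: mono; rewrite leq_divRL //= mulnC.
have := leq_trunc_div n q.+1; rewrite g; have := ltn_ord i; nia.
Qed.

Lemma leaf_cap_bounds r : (64 <= r)%N ->
  [/\ (2 ^ r %/ r ^ 3 * r ^ 3 <= 2 ^ r)%N, (r ^ 6 <= 2 ^ r %/ r ^ 3)%N
    & (2 ^ r < (2 ^ r %/ r ^ 3).+1 * r ^ 3)%N].
Proof.
move=> r64; have r3 : (0 < r ^ 3)%N by rewrite expn_gt0; lia.
split; first exact: leq_trunc_div.
  by rewrite leq_divRL // -expnD; apply: pow9_le_exp2.
exact: ltn_ceil.
Qed.

(** With [c] the cap, [q * r * c / 2 ^ r] is at least [r - 1], so the jump of the weight from [c] to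
    [2 ^ r] is paid for by a factor [expR (- (r - 1))]. *)
Lemma leaf_cap_ge r q : (64 <= r)%N -> (r ^ 3 <= q.+2)%N ->
  (r.-1 * 2 ^ r <= q * (r * (2 ^ r %/ r ^ 3)))%N.
Proof.
move=> r64 rq; have [c1 _ c3] := leaf_cap_bounds r64.
have := pow9_le_exp2 r64.
move: (2 ^ r)%N (2 ^ r %/ r ^ 3)%N c1 c3 => Q c c1 c3 rQ.
have r4 : (8 * r ^ 4 <= Q)%N.
  apply: leq_trans rQ; rewrite -[9%N]/(5 + 4)%N expnD leq_mul2r.
  by rewrite [(r ^ 5)%N]expnS (leq_trans _ (leq_pmulr _ _)) ?expn_gt0 ?orbT//; lia.
have rc : (8 * (r * c) <= Q)%N.
  apply: leq_trans c1; rewrite mulnC -mulnA mulnCA leq_mul2l; apply/orP; right.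
  rewrite -[3%N]/(1 + 2)%N expnD expn1 leq_mul2l; apply/orP; right.
  by apply: (@leq_trans (r * 1)); rewrite ?leq_mul2l ?expn_gt0; lia.
have h : (Q <= q.+2 * c + r ^ 3)%N.
  by rewrite mulSn in c3; have : (c * r ^ 3 <= q.+2 * c)%N; [rewrite mulnC leq_mul2r rq orbT|lia].
have h2 : (r * Q <= r * (q.+2 * c + r ^ 3))%N by rewrite leq_mul2l h orbT.
rewrite -subn1 mulnBl mul1n leq_subLR.
apply: leq_trans h2 _; rewrite mulnDr -expnS.
have -> : (r * (q.+2 * c) = q * (r * c) + 2 * (r * c))%N by rewrite -addn2; ring.
lia.
Qed.

(** Group 0 has weight 0. The jump to [r ^ 2] in group 1 is harmless since [2 ^ r] exceeds
    [8 * r ^ 6]. Steps by 1 are covered by [weight_step] with [t = r ^ 2], the jump to [2 ^ r] by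
    [leaf_cap_ge]. Afterwards the previous group leaves nothing free. *)
Lemma group_weight_bound (R : realType) r q g :
  (64 <= r)%N -> (r ^ 3 <= q.+2)%N -> (q <= 2 * r ^ 3)%N ->
  (group_weight r g * (2 ^ r - r * group_weight r g.-1) ^ q)%:R <=
    (1 + r%:R ^- 2) * ((2 ^+ r) ^+ q.+1 / (expR 1 * (r%:R * q%:R))) :> R.
Proof.
move=> r64 rq qr; have [c1 c2 c3] := leaf_cap_bounds r64.
have cge := leaf_cap_ge r64 rq; have r9 := pow9_le_exp2 r64.
have q0 : (0 < q)%N.
  have : (64 ^ 3 <= q.+2)%N by apply: leq_trans rq; rewrite leq_exp2r.
  by rewrite !expnS; lia.
have r0 : (0 < r)%N by lia.
have rR : 0 < r%:R :> R by rewrite ltr0n.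
have qR : 0 < q%:R :> R by rewrite ltr0n.
have e0 := expR_gt0 (1 : R); have e4 := expR1_le4 R.
set K := (X in _ <= X).
have M0 : 0 < (2 ^+ r) ^+ q.+1 / (expR 1 * (r%:R * q%:R)) :> R.
  by rewrite divr_gt0 ?exprn_gt0 // !mulr_gt0.
have K1 : (2 ^+ r) ^+ q.+1 / (expR 1 * (r%:R * q%:R)) <= K.
  by rewrite /K mulrDl mul1r lerDl mulr_ge0 ?(ltW M0) // invr_ge0 exprn_ge0.
have K0 : 0 <= K by exact: le_trans (ltW M0) K1.
have rc2 : (r ^ 2 <= 2 ^ r %/ r ^ 3)%N by apply: leq_trans c2; rewrite leq_pexp2l.
have small : (8 * r ^ 6 <= 2 ^ r)%N.
  apply: leq_trans r9; rewrite -[9%N]/(3 + 6)%N expnD leq_mul2r; apply/orP; right.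
  by rewrite -[8%N]/(2 ^ 3)%N leq_exp2r //; lia.
(* From [expR 1 <= 4] and [q <= 2 * r ^ 3], the product [expR 1 * (r * q)] is at most
   [8 * r ^ 4]. *)
have erq c : (c * (8 * r ^ 4) <= 2 ^ r)%N -> c%:R * (expR 1 * (r%:R * q%:R)) <= 2 ^+ r :> R.
  rewrite -(ler_nat R) [(2 ^ r)%:R]natrX => hc; apply: le_trans hc.
  rewrite natrM ler_wpM2l // -[8%N]/(4 * 2)%N -mulnA natrM.
  apply: ler_pM; rewrite ?mulr_ge0 ?(ltW e0) //.
  by rewrite -!natrM ler_nat expnS mulnCA leq_mul2l qr orbT.
case: g => [|[|h]]; first by rewrite mul0n.
  rewrite /= addn0 rc2 muln0 subn0 natrM !natrX.
  apply: le_trans K1; rewrite ler_pdivlMr ?mulr_gt0 // mulrAC [leRHS]exprSr mulrC.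
  rewrite ler_wpM2l ?exprn_ge0 // -natrX; apply: erq.
  by rewrite mulnCA -expnD.
rewrite [h.+2.-1]/=; set v := (r ^ 2 + h)%N.
rewrite [group_weight r h.+1]/= -/v; case: ifPn => [vc|_]; last first.
  have -> : (2 ^ r - r * 2 ^ r = 0)%N by apply/eqP; rewrite subn_eq0 leq_pmull.
  by rewrite exp0n // muln0.
have rvQ : (r * v <= 2 ^ r)%N.
  apply: leq_trans c1; rewrite mulnC; apply: leq_mul => //.
  by rewrite -{1}[r]expn1 leq_pexp2l.
rewrite [group_weight _ _]/= addnS -/v; case: ifPn => [_|].
  rewrite -addn1 natrM natrD natrX natrB // natrX natrM.
  apply: weight_step; rewrite ?exprn_gt0 // -?natrX ?ltr0n ?expn_gt0 ?r0 //.
    by rewrite ler_nat leq_addr.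
  by rewrite -natrM ler_nat.
rewrite -leqNgt => cv; have {cv vc} ev : v = (2 ^ r %/ r ^ 3)%N by lia.
rewrite -ev in cge.
rewrite natrM [X in _ * X]natrX natrB // natrM natrX.
apply: le_trans K1; rewrite exprS -mulrA ler_wpM2l ?exprn_ge0 //.
have Q0 : 0 < 2 ^+ r :> R by rewrite exprn_gt0.
have -> : 2 ^+ r - r%:R * v%:R = 2 ^+ r * (1 - r%:R * v%:R / 2 ^+ r) :> R.
  by field; rewrite gt_eqF.
rewrite exprMn ler_wpM2l ?exprn_ge0 //.
apply: le_trans (subr1X_le_expR _ _) _.
  by rewrite ler_pdivrMr // mul1r -natrX -natrM ler_nat.
rewrite expRN lef_pV2 ?posrE ?mulr_gt0 ?expR_gt0 //.
apply: (@le_trans _ _ (2 ^+ r.-1)).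
  rewrite -(ler_pM2l (ltr0Sn _ 1)) -exprS prednK //; apply: erq.
  apply: leq_trans small; rewrite mulnCA leq_mul2l /= -[6%N]/(2 + 4)%N expnD.
  by rewrite leq_mul2r; apply/orP; right; rewrite expnS; nia.
apply: (@le_trans _ _ (expR 1 ^+ r.-1)).
  by apply: lerXn2r; rewrite ?nnegrE ?expR_ge0 // expR1_ge2.
rewrite -expRM_natl mulr1 ler_expR mulrA ler_pdivlMr //.
by rewrite -natrX -!natrM ler_nat.
Qed.

Lemma sparse_iter_grow k s t j : (0 < k)%N -> (0 < s)%N ->
  sparse k s t -> sparse (k + j) (2 ^ j * s) (iter j grow t).
Proof.
move=> k0 s0 st; elim: j => [|j IH]; first by rewrite addn0 mul1n.
by rewrite addnS expnS -mulnA /=; apply: sparse_grow IH; rewrite ?addn_gt0 ?k0 // muln_gt0 expn_gt0.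
Qed.

Lemma deep_iter_grow k t j : deep t k -> deep (iter j grow t) (k + j).
Proof.
by move=> dt; elim: j => [|j IH]; rewrite ?addn0 // addnS /=; apply: deep_grow.
Qed.

Lemma f_le_round_tree (R : realType) r q j :
  (64 <= r)%N -> (r ^ 3 <= q.+2)%N -> (q <= 2 * r ^ 3)%N ->
  (f (q.+2 * r + j))%:R <=
    (1 + r%:R ^- 2) ^+ 2 *
      (2 ^+ (q.+2 * r + j).+1 / (expR 1 * (r%:R * q%:R))) :> R.
Proof.
move=> r64 rq qr.
have [c1 c2 c3] := leaf_cap_bounds r64; have r9 := pow9_le_exp2 r64.
pose K : R := (1 + r%:R ^- 2) * ((2 ^+ r) ^+ q.+1 / (expR 1 * (r%:R * q%:R))).
have gw g : (group_weight r g * (2 ^ r - r * group_weight r g.-1) ^ q)%:R <= K.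
  exact: group_weight_bound.
have gwE g : group_weight r g.+1 = if (r ^ 2 + g <= 2 ^ r %/ r ^ 3)%N then (r ^ 2 + g)%N else (2 ^ r)%N by [].
set c := (2 ^ r %/ r ^ 3)%N in c1 c2 c3 gwE.
have rc2 : (r ^ 2 <= c)%N by apply: leq_trans c2; rewrite leq_pexp2l //; lia.
pose w i := group_weight r (i %/ q.+1).
have q0 : (0 < q)%N.
  have : (64 ^ 3 <= q.+2)%N by apply: leq_trans rq; rewrite leq_exp2r.
  by rewrite !expnS; lia.
have r0 : (0 < r)%N by lia.
have rR : 0 < r%:R :> R by rewrite ltr0n.
have qR : 0 < q%:R :> R by rewrite ltr0n.
have e0 := expR_gt0 (1 : R).
pose a := (2 ^ r - r * c)%N.
have rcr : (r * c * r ^ 2 <= 2 ^ r)%N by apply: leq_trans c1; rewrite mulnAC mulnC -expnS.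
have rc : (4 * (r * c) <= 2 ^ r)%N.
  apply: leq_trans rcr; rewrite mulnC leq_mul2l; apply/orP; right.
  by rewrite -[4%N]/(2 ^ 2)%N leq_exp2r //; lia.
have Q8 : (8 <= 2 ^ r)%N by rewrite -[8%N]/(2 ^ 3)%N leq_exp2l //; lia.
have a1 : (2 ^ r <= 2 * a.-1)%N by rewrite /a; lia.
have hK i : (w i * free_prod r w i q)%:R <= K.
  by apply: le_trans (gw (i %/ q.+1)%N); rewrite ler_nat; apply: group_weight_free_prod.
(* Groups 1 to [c - r ^ 2 + 1] have the weights [r ^ 2] to [c]; round [L], the first of the next
   group, closes everything. *)
pose L := ((c - r ^ 2).+2 * q.+1)%N.
have ha i : (i < L)%N -> (a <= free r w i)%N.
  rewrite /L -ltn_divLR // => iL; rewrite /a leq_sub2l // leq_mul2l /w; apply/orP; right.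
  case: (i %/ q.+1)%N iL => // g gL; rewrite gwE ifT; last by lia.
  lia.
have hL : (2 ^ r <= r * w L)%N.
  rewrite /w /L mulnK // gwE ifN ?leq_pmull // -ltnNge.
  lia.
have hw i : (i <= q)%N -> w i = 0%N by move=> iq; rewrite /w divn_small.
pose B : R := K * (2 ^+ r.+1 + 2 ^+ r * ((2 ^+ r - a%:R) / (a%:R - 1))).
have aR : 0 < a%:R - 1 :> R by rewrite subr_gt0 ltr1n; lia.
have aE : 2 ^+ r - a%:R = (r * c)%:R :> R.
  by rewrite /a natrB ?natrX ?subKr //; lia.
have K0 : 0 <= K by exact: le_trans (hK 0%N).
have B0 : (2 ^ r * 2 ^ r)%:R <= B.
  have h : (2 ^ r)%:R <= K.
    apply: le_trans (gw 1%N); rewrite ler_nat gwE addn0 rc2.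
    rewrite muln0 subn0; apply: leq_trans (leq_pmull _ _); last by rewrite expn_gt0 r0.
    by rewrite -{1}[(2 ^ r)%N]expn1 leq_pexp2l // expn_gt0.
  rewrite /B natrM; apply: ler_pM => //.
  rewrite natrX exprS aE mulr2n mulrDl mul1r -addrA lerDl.
  by rewrite addr_ge0 ?exprn_ge0 // mulr_ge0 ?exprn_ge0 // divr_ge0 // ltW.
have B0' : 0 <= B by apply: le_trans B0.
pose s := Num.truncn B.
have hs v : v%:R <= B -> (v <= s)%N by rewrite truncn_ge_nat.
have a2 : (1 < a)%N by lia.
have st := sparse_round_tree hK (isT : 0 < L)%N ha a2 hL (hs _ B0) hs.
have dt : deep (round_tree r w L 0) (q.+2 * r).
  by rewrite mulnC -[X in (r * X)%N]subn0; apply: deep_round_tree hw _; rewrite add0n.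
have k0 : (0 < q.+2 * r)%N by rewrite muln_gt0.
have s0 : (0 < s)%N by apply: leq_trans (hs _ B0); rewrite muln_gt0 expn_gt0.
have k0j : (0 < q.+2 * r + j)%N by rewrite addn_gt0 k0.
have := f_lt_sparse k0j (deep_iter_grow j dt) (sparse_iter_grow j k0 s0 st).
move=> /ltnW fs; apply: (@le_trans _ _ (2 ^+ j * B)).
  apply: (@le_trans _ _ (2 ^ j * s)%:R); first by rewrite ler_nat.
  by rewrite natrM natrX ler_wpM2l ?exprn_ge0 // -truncn_ge_nat.
(* This error term gives one factor [1 + r%:R ^- 2]; the other is that of [K]. *)
have eps : (2 ^+ r - a%:R) / (a%:R - 1) <= 2 * r%:R ^- 2 :> R.
  rewrite ler_pdivrMr // aE mulrAC ler_pdivlMr ?exprn_gt0 //.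
  rewrite -natrX -natrM; apply: (@le_trans _ _ (2 ^ r)%:R); first by rewrite ler_nat.
  have -> : a%:R - 1 = a.-1%:R :> R by rewrite -subn1 (natrB _ (ltnW a2)).
  by rewrite -natrM ler_nat.
apply: (@le_trans _ _ (2 ^+ j * (K * (2 ^+ r.+1 + 2 ^+ r * (2 * r%:R ^- 2))))).
  by rewrite ler_wpM2l ?exprn_ge0 // ler_wpM2l // lerD2l ler_wpM2l ?exprn_ge0.
have -> : 2 ^+ (q.+2 * r + j).+1 = 2 ^+ j * ((2 ^+ r) ^+ q.+1 * 2 ^+ r.+1) :> R.
  by rewrite -exprM -!exprD; congr (_ ^+ _); rewrite !mulSn mulnC; lia.
rewrite le_eqVlt; apply/orP; left; apply/eqP.
rewrite /K [2 ^+ r.+1]exprS; field.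
by rewrite !gt_eqF.
Qed.

(** * Asymptotics *)

Lemma fourth_root_nat k : exists r, (r ^ 4 <= k < r.+1 ^ 4)%N.
Proof.
elim: k => [|k [r /andP[rk kr]]]; first by exists 0%N.
have [lt|ge] := ltnP k.+1 (r.+1 ^ 4); first by exists r; rewrite lt (leqW rk).
by exists r.+1; rewrite ge (leq_ltn_trans kr) ?ltn_exp2r.
Qed.

(** The tree is taken with [q.+2 = k %/ r] and grown [k %% r] times. The third factor
    [1 + r%:R ^- 2] pays for replacing [r * q] by [k]. *)
Lemma f_le_cube (R : realType) k r :
  (64 <= r)%N -> (r ^ 4 <= k < r.+1 ^ 4)%N ->
  (f k)%:R <= (1 + r%:R ^- 2) ^+ 3 * (2 ^+ k.+1 / (expR 1 * k%:R)) :> R.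
Proof.
move=> r64 /andP[rk kr]; have r0 : (0 < r)%N by lia.
have r3 : (64 * r ^ 2 <= r ^ 3)%N by rewrite [leqRHS]expnS leq_mul2r r64 orbT.
have r2 : (64 * r <= r ^ 2)%N by rewrite [leqRHS]expnS expn1 leq_mul2r r64 orbT.
have q3 : (r ^ 3 <= k %/ r)%N by rewrite leq_divRL // -expnSr.
have [q qE] : exists q, (k %/ r = q.+2)%N by exists (k %/ r - 2)%N; lia.
rewrite qE in q3.
have kE : k = (q.+2 * r + k %% r)%N by rewrite -qE -divn_eq.
have sqr : (8 * r.+1 ^ 2 <= 9 * r ^ 2)%N by rewrite [(r.+1 ^ 2)%N]expnS expn1; lia.
have qr : (q <= 2 * r ^ 3)%N.
  rewrite -(leq_pmul2r r0); apply: (@leq_trans k); first by rewrite {1}kE; lia.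
  apply: (leq_trans (ltnW kr)); rewrite -mulnA -expnSr.
  have : ((8 * r.+1 ^ 2) ^ 2 <= (9 * r ^ 2) ^ 2)%N by rewrite leq_exp2r.
  by rewrite (expnMn 8) (expnMn 9) -!expnM; lia.
have kq : (k * r ^ 2 <= (r ^ 2 + 1) * (r * q))%N.
  have : (k <= r * (q + 3))%N by rewrite {1}kE; have := ltn_pmod k r0; lia.
  move=> h; apply: (@leq_trans (r * (q + 3) * r ^ 2)); first by rewrite leq_mul2r h orbT.
  have -> : (r * (q + 3) * r ^ 2 = r * ((q + 3) * r ^ 2))%N by lia.
  by rewrite [leqRHS]mulnCA leq_mul2l; apply/orP; right; lia.
have q0 : (0 < q)%N by lia.
have k0 : (0 < k)%N by apply: leq_trans rk; rewrite expn_gt0 r0.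
have rR : 0 < r%:R :> R by rewrite ltr0n.
have qR : 0 < q%:R :> R by rewrite ltr0n.
have kR : 0 < k%:R :> R by rewrite ltr0n.
have e0 := expR_gt0 (1 : R).
have := @f_le_round_tree R r q (k %% r) r64 q3 qr; rewrite -kE => /le_trans; apply.
rewrite [(_ ^+ 3)]exprSr -[leRHS]mulrA.
rewrite ler_wpM2l ?exprn_ge0 // ?addr_ge0 ?invr_ge0 ?exprn_ge0 //.
rewrite [leRHS]mulrCA ler_wpM2l ?exprn_ge0 //.
rewrite !invfM [leRHS]mulrCA ler_wpM2l ?invr_ge0 ?(ltW e0) // -invfM.
rewrite ler_pdivlMr // mulrC ler_pdivrMr ?mulr_gt0 //.
rewrite (_ : 1 + _ = (r%:R ^+ 2 + 1) / r%:R ^+ 2); last by field; rewrite gt_eqF.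
rewrite mulrAC ler_pdivlMr ?exprn_gt0 //.
by rewrite -natrX natr1 -!natrM ler_nat -[(r ^ 2).+1]addn1.
Qed.

(** The constant is 28 = 7 * 4: for [u = r ^- 2 <= 1] the cube of [1 + u] is at most [1 + 7 * u],
    and [k < (r + 1) ^ 4 <= (2 * r) ^ 4] gives [u <= 4 / Num.sqrt k]. The threshold [64 ^ 4] ensures
    [64 <= r]. *)
Lemma f_upper_asymptotic (R : realType) : exists N : nat,
  forall k, (N <= k)%N ->
  (f k)%:R <= ((expR 1)^-1 + 28 / Num.sqrt k%:R) * (2 ^+ k.+1 / k%:R) :> R.
Proof.
exists (64 ^ 4)%N => k Nk; have [r /andP[rk kr]] := fourth_root_nat k.
have r64 : (64 <= r)%N.
  by rewrite -ltnS -(ltn_exp2r _ _ (isT : 0 < 4)%N); apply: leq_ltn_trans kr.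
have rk' : (r ^ 4 <= k < r.+1 ^ 4)%N by rewrite rk.
apply: le_trans (f_le_cube R r64 rk') _.
have k0 : (0 < k)%N by apply: leq_trans rk; rewrite expn_gt0; lia.
have kR : 0 < k%:R :> R by rewrite ltr0n.
have e0 := expR_gt0 (1 : R).
rewrite [(expR 1 * _)^-1]invfM [2 ^+ _ * _]mulrCA [leLHS]mulrA.
apply: ler_wpM2r; first by rewrite divr_ge0 ?exprn_ge0.
set u := r%:R ^- 2.
have rR : 64 <= r%:R :> R by rewrite ler_nat.
have u0 : 0 <= u by rewrite invr_ge0 exprn_ge0.
have u1 : u <= 1 by rewrite invf_le1 ?exprn_gt0 ?exprn_ege1 //; lra.
have s0 : 0 < Num.sqrt k%:R :> R by rewrite sqrtr_gt0.
have us : u <= 4 / Num.sqrt k%:R.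
  rewrite ler_pdivlMr // mulrC ler_pdivrMr ?exprn_gt0 //; last lra.
  have r4 : 0 <= 4 * r%:R ^+ 2 :> R by rewrite mulr_ge0 ?exprn_ge0.
  rewrite -(ger0_norm r4).
  rewrite -sqrtr_sqr; apply: ler_wsqrtr; rewrite -natrX -natrM -natrX ler_nat.
  apply: (leq_trans (ltnW kr)); rewrite expnMn -expnM.
  apply: (@leq_trans ((2 * r) ^ 4)); last by rewrite expnMn.
  by rewrite leq_exp2r //; lia.
have e1 : (expR 1)^-1 <= 1 :> R by rewrite invf_le1 // (le_trans _ (expR1_ge2 R)) // ler1n.
apply: (@le_trans _ _ ((1 + 7 * u) * (expR 1)^-1)).
  rewrite ler_wpM2r ?invr_ge0 ?(ltW e0) //.
  have u2 : u ^+ 2 <= u by rewrite expr2 ler_piMl.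
  have u3 : u ^+ 3 <= u by rewrite exprSr ler_piMl // (le_trans u2).
  rewrite [leLHS](_ : _ = 1 + 3 * u + 3 * u ^+ 2 + u ^+ 3); last by ring.
  lra.
rewrite mulrDl mul1r lerD2l.
apply: (@le_trans _ _ (7 * u)); first by rewrite ler_piMr // mulr_ge0.
by lra.
Qed.

(** * The lower bound from the local lemma *)

Lemma tautology_holds a (C : clause) :
  uniq C -> ~~ uniq (unzip1 C) -> clause_holds a C.
Proof.
elim: C => // -[x b] C IH /= /andP[xbC uC]; rewrite negb_and negbK.
move=> /orP[/mapP[[x' b'] xC /= e]|nu]; last by rewrite IH ?orbT.
subst x'; case: (eqVneq (a x) b) => //= ab; apply/hasP; exists (x, b') => //=.
have : b' != b by apply: contraNneq xbC => <-.
by case: b ab {xbC}; case: (b'); case: (a x).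
Qed.

Lemma count_conflicts_le C (F : formula) :
  (count (conflicts C) F <= \sum_(l <- C) count (fun D : clause => flip_lit l \in D) F)%N.
Proof.
elim: C => [|l C IH]; first by rewrite big_nil (eq_count (a2 := pred0)) ?count_pred0.
rewrite big_cons; apply: leq_trans (leq_add (leqnn _) IH).
by rewrite -count_predUI leq_addr.
Qed.

(** A clause without repeated variables does not contain both literals, so no clause is counted
    twice. *)
Lemma count_literals_le (F : formula) x :
  (forall C, C \in F -> uniq (unzip1 C)) ->
  (count (fun D : clause => (x, true) \in D) F +
   count (fun D : clause => (x, false) \in D) F <= count (var_in x) F)%N.
Proof.
move=> uF; rewrite -count_predUI [X in (_ + X)%N](eq_in_count (a2 := pred0)).
  rewrite count_pred0 addn0; apply: sub_count => D /orP[] xD; apply/hasP.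
    by exists (x, true) => /=.
  by exists (x, false) => /=.
move=> D DF /=; apply/negP => /andP[xt xf].
have := uF D DF; elim: D xt xf {DF} => // -[z b] D IH.
rewrite !inE /= => h1 h2 /andP[zD uD].
case/predU1P: h1 => [[ez eb]|h1]; case/predU1P: h2 => [[ez' eb']|h2].
- by rewrite -eb in eb'.
- by case/negP: zD; rewrite -ez; apply: (map_f fst h2).
- by case/negP: zD; rewrite -ez'; apply: (map_f fst h1).
- exact: IH.
Qed.

Lemma satisfiable_ks_cnf (R : realType) k s (F : formula) :
  (1 < k)%N -> (0 < s)%N -> expR 1 * (s.+1%:R * k%:R) <= 2 ^+ k.+1 :> R ->
  ks_cnf k s F -> satisfiable F.
Proof.
move=> k1 s0 hs [kF cF].
(* A clause with a repeated variable contains a complementary pair and always holds, so it is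
   discarded. *)
pose F' : formula := [seq C <- F | uniq (unzip1 C)].
suff [a /allP aF'] : satisfiable F'.
  exists a; apply/allP => C CF; case: (boolP (uniq (unzip1 C))) => uC.
    by apply: aF'; rewrite mem_filter uC.
  by apply: tautology_holds uC; have /andP[] := allP kF _ CF.
have uF' C : C \in F' -> uniq (unzip1 C) by rewrite mem_filter => /andP[].
have szF' C : C \in F' -> size C = k.
  by rewrite mem_filter => /andP[_ /(allP kF)/andP[_ /eqP]].
pose d l := count (fun D : clause => l \in D) F'.
have dle x : (d (x, true) + d (x, false) <= s)%N.
  apply: leq_trans (count_literals_le x uF') _; apply: leq_trans (cF x).
  by rewrite count_filter; apply: sub_count => D /andP[].
have sR : 0 < s%:R :> R by rewrite ltr0n.
have kR : 0 < k%:R :> R by rewrite ltr0n ltnW.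
have k2 : 2 <= k%:R :> R by rewrite ler_nat.
have skR : 0 < s%:R * k%:R :> R by rewrite mulr_gt0.
pose t : R := 2 / (s%:R * k%:R).
have t0 : 0 < t by rewrite divr_gt0.
pose del x : R := ((d (x, false))%:R *+ 2 - s%:R) / (s%:R * k%:R).
pose p x (b : bool) : R := 2^-1 * (1 + (if b then del x else - del x)).
have del1 x : `|del x| <= 1.
  rewrite ler_norml ler_pdivlMr // ler_pdivrMr // mulN1r mul1r.
  have h0 : 0 <= (d (x, false))%:R :> R by [].
  have h1 : (d (x, false))%:R <= s%:R :> R.
    by rewrite ler_nat; apply: leq_trans (dle x); apply: leq_addl.
  have h2 : s%:R <= s%:R * k%:R :> R by rewrite ler_peMr ?(ltW sR) //; lra.
  by rewrite !mulr2n; apply/andP; split; lra.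
have p0 x b : 0 <= p x b.
  rewrite mulr_ge0 //; move: (del1 x); rewrite ler_norml => /andP[h1 h2].
  by case: b; lra.
have p1 x : p x true + p x false = 1 by rewrite /p; lra.
(* For a positive literal this is just [1 + x <= expR x]. For a negative one [dle] is needed too,
   since [del] is defined through the negative occurrences. *)
have plit l : p l.1 (~~ l.2) <= 2^-1 * expR (k%:R^-1 - t * (d (flip_lit l))%:R).
  rewrite ler_wpM2l //; apply: le_trans (expR_ge1Dx _); rewrite lerD2l.
  have h : (d (l.1, true))%:R + (d (l.1, false))%:R <= s%:R :> R.
    by rewrite -natrD ler_nat.
  have -> : k%:R^-1 - t * (d (flip_lit l))%:R =
      (s%:R - (d (flip_lit l))%:R *+ 2) / (s%:R * k%:R) :> R.
    by rewrite /t; field; rewrite !gt_eqF.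
  case: l h => x [] /= h; rewrite /flip_lit /del /=.
    by rewrite -mulNr opprB.
  by rewrite ler_wpM2r ?invr_ge0 ?(ltW skR) // !mulr2n; lra.
have pC C : violation_prob p C <= 2^-1 ^+ size C *
    expR ((size C)%:R / k%:R - t * (\sum_(l <- C) d (flip_lit l))%:R).
  rewrite /violation_prob; elim: C => [|l C IH].
    by rewrite !big_nil mulr0 mul0r subr0 expR0 mulr1.
  rewrite !big_cons.
  have -> : (size (l :: C))%:R / k%:R - t * (d (flip_lit l) + \sum_(j <- C) d (flip_lit j))%:R =
     (k%:R^-1 - t * (d (flip_lit l))%:R) + ((size C)%:R / k%:R - t * (\sum_(j <- C) d (flip_lit j))%:R) :> R.
    by rewrite /= -natr1 natrD; ring.
  rewrite expRD exprS mulrACA; apply: ler_pM => //.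
  by apply: prodr_ge0.
(* By [expR (- t) <= (1 + t)^-1] the claim reduces to [expR 1 * (s * k + 2) <= 2 ^+ k.+1], which
   follows from [hs] because [2 <= k]. *)
have ylt : 2^-1 ^+ k * expR 1 <= 1 - expR (- t).
  have y1 : expR (- t) <= (1 + t)^-1.
    by rewrite expRN lef_pV2 ?posrE ?expR_gt0 ?expR_ge1Dx //; lra.
  apply: (@le_trans _ _ (t / (1 + t))); last first.
    have -> : t / (1 + t) = 1 - (1 + t)^-1 by field; lra.
    by rewrite lerD2l lerN2.
  have -> : t / (1 + t) = 2 / (s%:R * k%:R + 2).
    by rewrite /t; field; rewrite !gt_eqF //; lra.
  rewrite ler_pdivlMr; last lra.
  rewrite exprVn -mulrA ler_pdivrMl ?exprn_gt0 // -exprSr.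
  apply: le_trans hs; rewrite ler_wpM2l ?expR_ge0 // -[s.+1%:R]natr1 mulrDl mul1r.
  by lra.
pose n := (\max_(l <- flatten F') l.1).+1.
apply: (@lopsided_local_lemma R p p0 p1 n F' (expR (- t)) xpredT) => //.
- move=> C CF; apply/allP => l lC; rewrite ltnS.
  apply: (@leq_bigmax_seq _ _ xpredT (fun l : literal => l.1)) => //.
  by apply/flattenP; exists C.
- exact: expR_gt0.
- by rewrite -expR0 ler_expR; lra.
move=> C CF; apply: le_trans (pC C) _; rewrite szF' // divff ?gt_eqF //.
rewrite expRD mulrA; apply: ler_pM => //; rewrite ?mulr_ge0 ?exprn_ge0 ?expR_ge0 //.
rewrite -expRM_natl mulrN ler_expR lerN2 mulrC ler_wpM2l ?(ltW t0) // ler_nat.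
exact: count_conflicts_le.
Qed.

Lemma floor_le_f (R : realType) k : (0 < k)%N ->
  Num.floor (2 ^+ k.+1 / (expR 1 * k%:R) : R) - 1 <= (f k)%:Z.
Proof.
move=> k0; have e0 := expR_gt0 (1 : R).
have kR : 0 < k%:R :> R by rewrite ltr0n.
have := floor_le (2 ^+ k.+1 / (expR 1 * k%:R) : R).
(* A floor below 2 leaves nothing to prove. Otherwise it is [s.+2], and [satisfiable_ks_cnf] is used
   at [s.+1]. *)
case: (Num.floor _) => [[|[|s]]|m] le; [by []|by []| |by rewrite NegzE; lia].
have {}le : expR 1 * (s.+2%:R * k%:R) <= 2 ^+ k.+1 :> R.
  by move: le; rewrite ler_pdivlMr ?mulr_gt0 // mulrCA.
have [_ maxf] := fP k0.
suff : (s.+1 <= f k)%N by lia.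
apply: maxf => G; apply: (@satisfiable_ks_cnf R) => //.
(* For [k = 1] the inequality [le] would bound [expR 1 * s.+2] by 4, although [expR 1 > 2]. *)
rewrite ltn_neqAle k0 andbT; apply/eqP => k1; move: le; rewrite -k1 mulr1.
have e2 : 2 < expR 1 :> R by have := @expR_gt1Dx R 1 (oner_neq0 _); lra.
have s2 : 2 <= s.+2%:R :> R by rewrite ler_nat.
by rewrite expr2 => le; nra.
Qed.

Theorem theorem1 (R : realType) :
  (forall k : nat, (0 < k)%N ->
     Num.floor (2 ^+ k.+1 / (expR 1 * k%:R) : R) - 1 <= (f k)%:Z) /\
  (exists g : nat -> R,
     (g =O_\oo (fun k : nat => (k%:R : R) `^ (- 2^-1))) /\
     (forall k : nat, (0 < k)%N ->
        (f k)%:R = ((expR 1)^-1 + g k) * (2 ^+ k.+1 / k%:R))).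
Proof.
split; first exact: floor_le_f.
(* The exact identity for positive [k] forces this choice. *)
exists (fun k => (f k)%:R / (2 ^+ k.+1 / k%:R) - (expR 1)^-1); split; last first.
  move=> k k0; have kR : k%:R != 0 :> R by rewrite pnatr_eq0 -lt0n.
  by rewrite addrC subrK divfK // mulf_neq0 ?invr_eq0 ?expf_neq0.
have [N up] := f_upper_asymptotic R.
apply/eqO_exP; exists 28 => //; exists (maxn N 64) => // k /=.
rewrite geq_max => /andP[Nk k64].
have k0 : (0 < k)%N by lia.
have kR : 0 < k%:R :> R by rewrite ltr0n.
have P0 : 0 < 2 ^+ k.+1 / k%:R :> R by rewrite divr_gt0 ?exprn_gt0.
rewrite powRN powR12_sqrt // [`|_ ^-1|]ger0_norm ?invr_ge0 ?sqrtr_ge0 //.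
rewrite ler_norml; apply/andP; split; last first.
  by rewrite lerBlDl ler_pdivrMr // up.
have sk0 : 0 < Num.sqrt k%:R :> R by rewrite sqrtr_gt0.
have low : 2 ^+ k.+1 / (expR 1 * k%:R) - 2 <= (f k)%:R :> R.
  have := floor_le_f R k0; rewrite -(ler_int R) rmorphB /=.
  have := floorD1_gt (2 ^+ k.+1 / (expR 1 * k%:R) : R); rewrite rmorphD /=.
  by move=> h1 h2; lra.
rewrite lerBrDr ler_pdivlMr //; apply: le_trans low.
have -> : 2 ^+ k.+1 / (expR 1 * k%:R) = (expR 1)^-1 * (2 ^+ k.+1 / k%:R) :> R.
  by rewrite invfM mulrCA.
rewrite mulrDl addrC lerD2l mulNr lerN2.
(* The loss of 2 in [low], from the floor and the subtracted 1, is absorbed since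
   [k * Num.sqrt k <= k * k <= 2 ^ k]. *)
have kk : (k * k <= 2 ^ k)%N.
  by apply: leq_trans (pow9_le_exp2 k64); rewrite mulnn leq_pexp2l.
rewrite mulrA ler_pdivlMr // mulrAC ler_pdivlMr //.
have sk : Num.sqrt k%:R <= k%:R :> R.
  rewrite -[leRHS](ger0_norm (ltW kR)) -sqrtr_sqr ler_wsqrtr //.
  by rewrite expr2 ler_peMl ?ler1n // ltW.
have kkR : k%:R * k%:R <= 2 ^+ k :> R by rewrite -natrM -natrX ler_nat.
have := ler_wpM2l (ltW kR) sk; have := exprn_ge0 k (ler0n R 2).
by rewrite exprS; lra.
Qed.
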